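(* For each $0<\alpha<1$ and each integer $d\ge2$, the subset $[0,1)\setminus\mathscr{D}_{\alpha,d}$ is of the first Baire category.
   Context: For a sequence $(x_n)_{n\in\mathbb{N}}$ in $[0,1)$ its (unnormalized) discrepancy at length $N$ is $$D_N=\sup_{0\le a<b\le1}\bigl|\#\{1\le n\le N:\ x_n\in(a,b)\}-(b-a)N\bigr|.$$ For $x\in[0,1)$, $\Delta_d(x;N)$ denotes the discrepancy at length $N$ of the sequence of fractional parts of $xn^d$, $n\in\mathbb{N}$. Define $$\mathscr{D}_{\alpha,d}=\{x\in[0,1):\ \Delta_d(x;N)\ge N^{\alpha}\text{ for infinitely many }N\in\mathbb{N}\}.$$ A subset of $\mathbb{R}$ is nowhere dense if its closure has empty interior, and is of the first Baire category if it is a countable union of nowhere dense sets. *)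

(* Defs.v *)
From mathcomp Require Import all_boot all_order all_algebra.
From mathcomp Require Import all_classical all_reals all_analysis.
Import Order.TTheory GRing.Theory Num.Theory numFieldNormedType.Exports.

Set Implicit Arguments.
Unset Strict Implicit.
Unset Printing Implicit Defensive.

Local Open Scope classical_set_scope.
Local Open Scope ring_scope.

Definition frac_part (R : realType) (x : R) : R := x - (Num.floor x)%:~R.

(* The indices are 1 <= n <= N: the term [x 0] plays no role.  The set below is
   nonempty and contained in [0, N], so [sup] is a genuine supremum. *)
Definition discrepancy (R : realType) (x : nat -> R) (N : nat) : R :=
  sup [set D : R | exists a b : R, [/\ 0 <= a, a < b, b <= 1 &
    D = `|(count (fun n : nat => (a < x n < b)%R) (index_iota 1 N.+1))%:R
          - (b - a) * N%:R|]].

Definition monomial_discrepancy (R : realType) (d : nat) (x : R) (N : nat) : R :=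
  discrepancy (fun n => frac_part (x * n%:R ^+ d)) N.

Definition large_discrepancy_set (R : realType) (alpha : R) (d : nat) : set R :=
  [set x : R | (0 <= x < 1) /\
    infinite_set [set N : nat | N%:R `^ alpha <= monomial_discrepancy d x N]].

Definition nowhere_dense (T : topologicalType) (A : set T) : Prop :=
  interior (closure A) = set0.

Definition first_category (T : topologicalType) (A : set T) : Prop :=
  exists F : nat -> set T,
    (forall n, nowhere_dense (F n)) /\ A = \bigcup_n F n.

(* Main.v *)
Require Import Defs.
From mathcomp Require Import all_boot all_order all_algebra.
From mathcomp Require Import all_classical all_reals all_analysis.
From mathcomp Require Import ring lra.
Import Order.TTheory GRing.Theory Num.Theory numFieldNormedType.Exports.

(** The set [[0, 1[] minus [large_discrepancy_set alpha d] is the union over m of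
    the sets E_m of those x in [[0, 1[] with discrepancy below N^alpha at every
    length N >= m, so it suffices that each E_m is nowhere dense.

    Fix a rational a/q.  The points (a/q) n^d mod 1 all lie on the grid of
    multiples of 1/q, so the open interval between 1/(4q) and 3/(4q) stays at
    distance at least 1/(4q) from all of them.  Given N, if x is close enough to a/q,
    namely |x - a/q| N^d < 1/(4q), the points x n^d mod 1 with n <= N are within
    1/(4q) of the grid, hence still miss that interval
    ([frac_part_near_rational]), and an empty interval of length 1/(2q) forces
    discrepancy at least N/(2q) ([monomial_discrepancy_near_rational]).  As
    alpha < 1, this exceeds N^alpha once N is large ([powR_le_linear]); choosing
    such an N >= m produces a whole neighbourhood of a/q disjoint from E_m.
    Every rational thus lies outside the closure of E_m, and rationals are
    dense. *)

Local Open Scope classical_set_scope.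
Local Open Scope ring_scope.

Lemma nat_finite_setP (A : set nat) :
  finite_set A <-> exists m, forall n, (m <= n)%N -> ~ A n.
Proof.
split=> [/finite_seqP[s ->]|[m Am]].
  exists (\max_(i <- s) i).+1 => n mn /= ns.
  by move: mn; rewrite ltnNge leq_bigmax_seq.
apply: (sub_finite_set _ (finite_II m)) => n An /=.
by rewrite ltnNge; apply/negP => /Am.
Qed.

(** An interval without points contributes its full expected count as error.
    Since [sup] is only an upper bound on bounded sets, the proof also has to
    bound all deviations, here by 2N. *)
Lemma discrepancy_ge_gap (R : realType) (x : nat -> R) (N : nat) (a b : R) :
  0 <= a -> a < b -> b <= 1 ->
  (forall n, (1 <= n <= N)%N -> ~~ (a < x n < b)) ->
  (b - a) * N%:R <= discrepancy x N.
Proof.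
move=> a0 ab b1 gap; apply: ub_le_sup.
  exists (N%:R + N%:R) => _ [a' [b' [a'0 ab' b'1 ->]]].
  apply: le_trans (ler_normB _ _) _; apply: lerD.
    rewrite ger0_norm// ler_nat; apply: leq_trans (count_size _ _) _.
    by rewrite size_iota subn1.
  rewrite ger0_norm; last by rewrite mulr_ge0// subr_ge0 ltW.
  by rewrite ler_piMl//; lra.
exists a, b; split=> //.
rewrite (_ : count _ _ = 0%N) ?sub0r ?normrN.
  by rewrite ger0_norm// mulr_ge0// subr_ge0 ltW.
apply/eqP; rewrite -leqn0 leqNgt -has_count; apply/hasPn => n.
by rewrite mem_index_iota ltnS; exact: gap.
Qed.

(** With f the floor of y, if q * frac_part y were strictly between 1/4 and 3/4,
    the integer k - q * f, which is within 1/4 of it, would be strictly between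
    0 and 1. *)
Lemma frac_part_near_rational (R : realType) (y : R) (k q : int) : 0 < q ->
  `|y - k%:~R / q%:~R| <= (4 * q%:~R)^-1 ->
  ~~ ((4 * q%:~R)^-1 < frac_part y < 3 * (4 * q%:~R)^-1).
Proof.
move=> q0 yk; apply/negP => /andP[lo hi].
have q0R : 0 < q%:~R :> R by rewrite ltr0z.
pose j := k - q * Num.floor y.
have qu : q%:~R * (4 * q%:~R)^-1 = 4^-1 :> R.
  by rewrite invfM mulrCA divff ?mulr1// gt_eqF.
have jE : j%:~R = q%:~R * frac_part y - q%:~R * (y - k%:~R / q%:~R) :> R.
  rewrite /frac_part rmorphB rmorphM /= !mulrBr [q%:~R * (_ / _)]mulrCA.
  by rewrite divff ?mulr1 ?gt_eqF//; lra.
move: lo; rewrite -(ltr_pM2l q0R) qu => lo.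
move: hi; rewrite -(ltr_pM2l q0R) mulrCA qu => hi.
move: yk; rewrite -(ler_pM2l q0R) qu -{1}(gtr0_norm q0R) -normrM ler_norml.
move=> /andP[lo' hi'].
have j0 : 0 < j%:~R :> R by rewrite jE; lra.
have j1 : j%:~R < 1%:~R :> R by rewrite jE; lra.
by move: j0 j1; rewrite ltr0z ltr_int gtz0_ge1 leNgt => /negbTE->.
Qed.

(** The gap between 1/(4q) and 3/(4q) survives for all n <= N at once, because
    replacing a/q by x moves the n-th point by |x - a/q| n^d, which is largest
    at n = N. *)
Lemma monomial_discrepancy_near_rational (R : realType) (d N : nat)
    (x : R) (a q : int) : 0 < q ->
  `|x - a%:~R / q%:~R| * N%:R ^+ d <= (4 * q%:~R)^-1 ->
  (2 * q%:~R)^-1 * N%:R <= monomial_discrepancy d x N.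
Proof.
move=> q0 xa.
have q1 : 1 <= q%:~R :> R by rewrite ler1z -gtz0_ge1.
have u0 : 0 < (4 * q%:~R)^-1 :> R by rewrite invr_gt0; lra.
have u1 : (4 * q%:~R)^-1 <= 4^-1 :> R by rewrite lef_pV2 ?posrE; lra.
rewrite (_ : (2 * _)^-1 = 3 * (4 * q%:~R)^-1 - (4 * q%:~R)^-1 :> R); last first.
  by field; rewrite gt_eqF//; lra.
apply: discrepancy_ge_gap; [exact: ltW|lra|lra|] => n /andP[_ nN].
apply: (@frac_part_near_rational _ _ (a * n%:Z ^+ d)) => //.
apply: le_trans xa; rewrite rmorphM rmorphXn /= mulrAC -mulrBl normrM.
rewrite ler_wpM2l// ger0_norm ?exprn_ge0//.
by rewrite lerXn2r ?nnegrE ?ler0n// ler_nat.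
Qed.

(** Dividing by N^alpha, the inequality reads 1 <= c N^(1 - alpha), and the
    exponent 1 - alpha is positive; the threshold is c^(-1/(1 - alpha)). *)
Lemma powR_le_linear (R : realType) (alpha c : R) : alpha < 1 -> 0 < c ->
  exists M : nat, forall N, (M <= N)%N -> N%:R `^ alpha <= c * N%:R.
Proof.
move=> a1 c0; have b0 : 0 < 1 - alpha by rewrite subr_gt0.
pose B : R := c^-1 `^ (1 - alpha)^-1.
(* The successor makes N positive, which powers with real exponents need. *)
exists (Num.bound B).+1 => N MN.
have BN : B <= N%:R.
  rewrite (le_trans (ltW (archi_boundP (powR_ge0 _ _))))// ler_nat.
  exact: ltnW.
have N0 : 0 < N%:R :> R by rewrite ltr0n (leq_trans _ MN).
have -> : c * N%:R = N%:R `^ alpha * (c * N%:R `^ (1 - alpha)).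
  rewrite mulrCA -powRD; last by rewrite (gt_eqF N0) implybT.
  by rewrite addrC subrK powRr1 ?ltW.
rewrite ler_peMr ?powR_ge0// -ler_pdivrMl// mulr1.
have <- : B `^ (1 - alpha) = c^-1.
  by rewrite /B -powRrM mulVf ?gt_eqF// powRr1// invr_ge0 ltW.
apply: ge0_ler_powR; rewrite ?nnegrE ?powR_ge0 ?ler0n//; exact: ltW.
Qed.

(** Density of the rationals: a ball inside the closure of A would contain a
    rational, which the hypothesis keeps away from A. *)
Lemma nowhere_dense_avoid_rational (R : realType) (A : set R) :
  (forall r : rat, exists2 e : R, 0 < e &
    forall x, `|x - ratr r| < e -> ~ A x) ->
  @nowhere_dense R A.
Proof.
move=> avoid; apply/seteqP; split=> // y /nbhs_ballP[e /= e0 ye].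
have [r] : exists r, ratr r \in `]y, y + e[.
  by apply: rat_in_itvoo; rewrite ltrDl.
rewrite in_itv /= => /andP[yr re].
have [e' e'0 Ae'] := avoid r.
have : closure A (ratr r).
  by apply: ye; rewrite /ball /= distrC gtr0_norm; lra.
move=> /(_ (ball (ratr r : R) e')) -[|x [Ax]].
  exact: (nbhsx_ballx (ratr r : R) e' e'0).
by rewrite /ball /= distrC => /Ae'.
Qed.

Lemma nowhere_dense_eventually_small_discrepancy (R : realType) (alpha : R)
    (d m : nat) : alpha < 1 ->
  @nowhere_dense R [set x | forall N : nat, (m <= N)%N ->
    ~ N%:R `^ alpha <= monomial_discrepancy d x N].
Proof.
move=> a1; apply: nowhere_dense_avoid_rational => r.
have q0 : 0 < (denq r)%:~R :> R by rewrite ltr0z.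
have [|M powM] := @powR_le_linear R alpha (2 * (denq r)%:~R)^-1 a1.
  by rewrite invr_gt0 mulr_gt0.
(* The successor keeps N ^ d nonzero when m = M = 0. *)
pose N := (maxn m M).+1.
have Nd0 : 0 < N%:R ^+ d :> R by rewrite exprn_gt0.
exists ((4 * (denq r)%:~R)^-1 / N%:R ^+ d).
  by rewrite divr_gt0// invr_gt0 mulr_gt0.
move=> x; rewrite ltr_pdivlMr// => /ltW xr /(_ N); apply.
  by rewrite ltnW// ltnS leq_maxl.
apply: le_trans (powM _ _) _; first by rewrite ltnW// ltnS leq_maxr.
exact: (@monomial_discrepancy_near_rational _ _ _ _ (numq r)).
Qed.

Lemma nowhere_dense_subset (T : topologicalType) (A B : set T) :
  A `<=` B -> nowhere_dense B -> nowhere_dense A.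
Proof.
move=> AB; rewrite /nowhere_dense -!subset0; apply: subset_trans.
by apply: interiorS; apply: closureS.
Qed.

Theorem theorem1p11 (R : realType) (alpha : R) (d : nat)
  (alpha_gt0 : 0 < alpha) (alpha_lt1 : alpha < 1) (d_ge2 : (2 <= d)%N) :
  @first_category R (`[0, 1[ `\` large_discrepancy_set alpha d).
Proof.
exists (fun m => `[0, 1[ `&` [set x : R | forall N : nat, (m <= N)%N ->
  ~ N%:R `^ alpha <= monomial_discrepancy d x N]); split=> [m|].
  apply: nowhere_dense_subset (@subIsetr _ _ _) _.
  exact: nowhere_dense_eventually_small_discrepancy.
rewrite -setI_bigcupr; apply/seteqP; split=> [x [x01 xD]|x [x01 [m _ xm]]].
  split=> //.
  have /nat_finite_setP[m xm] :
      finite_set [set N : nat | N%:R `^ alpha <= monomial_discrepancy d x N].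
    apply: contrapT => infx; apply: xD; split=> //=.
  by exists m.
split=> // -[_]; apply; apply/nat_finite_setP.
by exists m.
Qed.
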